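(* Let $d\ge 2$, $k\ge 2$, $1\le l\le k-1$, and let $V\subset\mathbb{R}^{n_d(k)}$ be a linear subspace with $0<\dim V<n_d(k)$, spanned by column vectors $v_1,\dots,v_{\dim V}$. For $t\in[0,1]^d$ let $\mathcal{M}^{(l)}(t)$ be the $n_d(k)\times n_d(l)$ matrix whose columns are the vectors $\partial^\alpha\Phi_{d,k}(t)$, $\alpha$ running over all multi-indices with $1\le|\alpha|\le l$, and let $\mathcal{M}^{(l)}_V(t)=(v_1,\dots,v_{\dim V})^T\mathcal{M}^{(l)}(t)$, a $\dim V\times n_d(l)$ matrix. Then $\mathcal{M}^{(l)}_V(t)$ has at least one minor of order $$\Big[\frac{\dim V\cdot n_d(l)}{n_d(k)}\Big]+1$$ whose determinant, as a function of $t\in[0,1]^d$, does not vanish identically.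
   Context: $n_d(m)=\binom{d+m}{m}-1$. $\Phi_{d,k}:[0,1]^d\to\mathbb{R}^{n_d(k)}$ is the map whose entries are all monomials $t_1^{i_1}\cdots t_d^{i_d}$ with $i_j\ge0$ and $1\le i_1+\dots+i_d\le k$. $[x]$ denotes the largest integer not exceeding $x$. *)

(* Defs.v *)
From HB Require Import structures.
From mathcomp Require Import all_boot all_order all_algebra.
From mathcomp Require Import all_classical all_reals all_analysis.
Set Implicit Arguments.
Unset Strict Implicit.
Unset Printing Implicit Defensive.
Import Order.TTheory GRing.Theory Num.Theory.
Import numFieldNormedType.Exports.
Local Open Scope ring_scope.

Definition nd (d m : nat) : nat := ('C(d + m, m) - 1)%N.

(* Entries of a multi-index of degree at most [m] are at most [m], so the
   multi-indices of degree between 1 and [m] form a finite set. *)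
Definition multi_indices (d m : nat) : {set d.-tuple 'I_m.+1} :=
  [set a : d.-tuple 'I_m.+1 | (1 <= \sum_(i <- a) i <= m)%N].

Lemma card_multi_indices (d m : nat) : #|multi_indices d m| = nd d m.
Proof.
have -> : multi_indices d m =
    [set a : d.-tuple 'I_m.+1 | (\sum_(i <- a) i <= m)%N] :\ [tuple of nseq d ord0].
  apply/setP => a; rewrite !inE; congr andb.
  rewrite lt0n; congr negb; rewrite sum_nat_seq_eq0; apply/idP/eqP.
    move/allP => h; apply: eq_from_tnth => i; apply/val_inj/eqP.
    rewrite (tnth_nth ord0 [tuple of nseq d ord0]) /= nth_nseq if_same.
    exact: (h _ (mem_tnth i a)).
  by move=> ->; apply/allP => i /nseqP[-> _].
set A := [set a : d.-tuple 'I_m.+1 | _].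
have hA : [tuple of nseq d ord0] \in A.
  by rewrite inE big1_seq // => i /andP[_ /nseqP[-> _]].
have := cardsD1 [tuple of nseq d ord0] A.
rewrite hA card_partial_ord_partitions /nd -bin_sub ?leq_addr // addKn => ->.
by rewrite addKn.
Qed.

(* A fixed enumeration of the multi-indices, used both for the coordinates of
   R^(nd d k) and for the columns of the matrix of derivatives. *)
Definition multi_index (d m : nat) (i : 'I_(nd d m)) : d.-tuple 'I_m.+1 :=
  enum_val (cast_ord (esym (card_multi_indices d m)) i).

Definition unit_cube (R : realType) (d : nat) (t : 'rV[R]_d) : Prop :=
  forall j, 0 <= t 0 j <= 1.

(* The polynomial map is defined on all of R^d; only its values and derivatives
   at points of [0,1]^d are used. *)
Definition Phi (R : realType) (d k : nat) (t : 'rV[R]_d) : 'cV[R]_(nd d k) :=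
  \col_(i < nd d k) \prod_(j < d) t 0 j ^+ tnth (multi_index i) j.

Definition partial (R : realType) (d : nat) (W : normedModType R) (j : 'I_d)
  (f : 'rV[R]_d -> W) : 'rV[R]_d -> W :=
  fun t => 'D_(delta_mx 0 j : 'rV[R]_d) f t.

Definition multi_partial (R : realType) (d m : nat) (W : normedModType R)
    (a : d.-tuple 'I_m.+1) (f : 'rV[R]_d -> W) : 'rV[R]_d -> W :=
  foldr (fun j g => iter (tnth a j) (partial j) g) f (enum 'I_d).

Definition derivative_mx (R : realType) (d k l : nat) (t : 'rV[R]_d) :
    'M[R]_(nd d k, nd d l) :=
  \matrix_(i < nd d k, c < nd d l)
    multi_partial (multi_index c) (@Phi R d k) t i 0.

Definition columns_mx (R : realType) (n m : nat) (v : m.-tuple 'cV[R]_n) :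
    'M[R]_(n, m) :=
  \matrix_(i < n, j < m) tnth v j i 0.

Definition derivative_mx_on (R : realType) (d k l m : nat)
    (v : m.-tuple 'cV[R]_(nd d k)) (t : 'rV[R]_d) : 'M[R]_(m, nd d l) :=
  (columns_mx v)^T *m derivative_mx k l t.

(* Main.v *)
Require Import Defs.
From HB Require Import structures.
From mathcomp Require Import all_boot all_order all_algebra.
From mathcomp Require Import all_classical all_reals all_analysis.
From mathcomp Require Import ring.
Set Implicit Arguments.
Unset Strict Implicit.
Unset Printing Implicit Defensive.
Import Order.TTheory GRing.Theory Num.Theory.
Import numFieldNormedType.Exports.
Local Open Scope ring_scope.

(* [V] is a space of polynomials without constant term, of degree at most [k],
   and the matrix at [t] records their [l]-jets. On monomials these jets are
   falling factorials: [derivative_mx k l t] is, up to invertible diagonal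
   factors, the constant matrix [F(a, b) = prod_j a_j (a_j - 1) ... (a_j - b_j + 1)].
   Along the curve [t_j = s ^ w_j], with weights [w] that separate the
   multi-indices, [V] degenerates as [s -> 0] to the span of a set [S] of
   [dim V] monomials, and ranks can only drop in the limit; so it suffices to
   bound the rank of the rows [S] of [F]. The columns [b] that are independent
   of the preceding ones in a graded order form a set [T] closed under
   decreasing an exponent (multiply a relation by [a_j - b_j]), with
   [#|T| = dim V], and the rank sought is the number of elements of [T] of
   degree at most [l]. Counting neighbours between consecutive degrees shows
   that the density of [T] in degree [i] is nonincreasing in [i], and it cannot
   be constant unless [T] is empty or full: hence the strict inequality. *)

(** * Greedy row bases for a ranking [N] of the rows *)

Section PivotRows.
Variables (F : fieldType) (n q : nat) (X : 'M[F]_(n, q)) (N : 'I_n -> nat).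

(** The ranking [N] is kept apart from the row index so that the natural order and the order by
    [key] can both be used. *)
Definition span_before (c : nat) : 'M[F]_q :=
  (\sum_(i | (N i < c)%N) <<row i X>>)%MS.

Definition pivot_rows : {set 'I_n} :=
  [set i | ~~ (row i X <= span_before (N i))%MS].

Lemma row_sub_span_before i c :
  (N i < c)%N -> (row i X <= span_before c)%MS.
Proof.
move=> lic; suff: (<<row i X>> <= span_before c)%MS by rewrite genmxE.
exact: sumsmx_sup lic _.
Qed.

Lemma span_before_sub m (B : 'M[F]_(m, q)) c :
  (forall i, (N i < c)%N -> (row i X <= B)%MS) -> (span_before c <= B)%MS.
Proof. by move=> h; apply/sumsmx_subP => i lic; rewrite genmxE h. Qed.

Lemma span_beforeS m c : (c <= m)%N -> (span_before c <= span_before m)%MS.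
Proof.
move=> lcm; apply: span_before_sub => i lic.
exact/row_sub_span_before/(leq_trans lic).
Qed.

Lemma span_before_pivots c :
  (span_before c <=
     \sum_(i | (N i < c)%N && (i \in pivot_rows)) <<row i X>>)%MS.
Proof.
elim: c => [|c IH]; first by apply: span_before_sub.
have {}IH : (span_before c <=
    \sum_(i | (N i < c.+1)%N && (i \in pivot_rows)) <<row i X>>)%MS.
  apply: submx_trans IH _; apply/sumsmx_subP => i /andP[lic pi].
  by apply: (sumsmx_sup i) => //; rewrite pi ltnS ltnW.
apply: span_before_sub => i lic.
have [pi|] := boolP (i \in pivot_rows).
  suff: (<<row i X>> <= \sum_(j | (N j < c.+1)%N && (j \in pivot_rows))
                          <<row j X>>)%MS by rewrite genmxE.
  by apply: (sumsmx_sup i) => //; rewrite lic pi.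
rewrite inE negbK => /submx_trans; apply; apply: submx_trans IH.
exact: span_beforeS.
Qed.

Lemma sub_pivot_rowsub m (p : 'I_m -> 'I_n) :
  (forall a, a \in pivot_rows -> exists i, a = p i) -> (X <= rowsub p X)%MS.
Proof.
move=> hp; apply/row_subP => a.
have /submx_trans := @row_sub_span_before a (N a).+1 (ltnSn _); apply.
apply: submx_trans (span_before_pivots _) _.
apply/sumsmx_subP => b /andP[_ /hp[i ->]]; rewrite genmxE -row_rowsub.
exact: row_sub.
Qed.

Hypothesis N_inj : injective N.

(** As [N] is injective, raising the bound by one adds at most one row, and the rank grows exactly
    when that row is a pivot. *)
Lemma rank_span_before c :
  \rank (span_before c) = #|[set i in pivot_rows | (N i < c)%N]|.
Proof.
elim: c => [|c IH].
  rewrite /span_before big_pred0 // mxrank0.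
  by apply/esym/eqP; rewrite cards_eq0; apply/eqP/setP => i; rewrite !inE andbF.
have [i /eqP Ni|noi] := pickP (fun i => N i == c); last first.
  suff eS i : (N i < c.+1)%N = (N i < c)%N.
    by rewrite /span_before (eq_bigl _ _ eS) [LHS]IH; apply/eq_card => i; rewrite !inE eS.
  by rewrite ltnS leq_eqVlt noi.
have eS j : (N j < c.+1)%N = (j == i) || (N j < c)%N.
  by rewrite ltnS leq_eqVlt -Ni (inj_eq N_inj).
have eqS : (span_before c.+1 :=: <<row i X>> + span_before c)%MS.
  rewrite /span_before (bigD1 i) /= ?eS ?eqxx //.
  rewrite (eq_bigl (fun j => (N j < c)%N)) // => j.
  by rewrite eS; case: eqVneq => [->|_]; rewrite ?andbT ?Ni ?ltnn.
rewrite eqS.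
have -> : [set j in pivot_rows | (N j < c.+1)%N] =
    if i \in pivot_rows then i |: [set j in pivot_rows | (N j < c)%N]
    else [set j in pivot_rows | (N j < c)%N].
  case: ifP => pi; apply/setP => j; rewrite !inE eS;
    case: eqVneq => [->|//]; last by move: pi; rewrite inE => ->.
  by move: pi; rewrite inE => ->.
have Si : (i \in [set j in pivot_rows | (N j < c)%N]) = false.
  by rewrite !inE Ni ltnn andbF.
case: ifP; rewrite inE Ni => pi; last first.
  have le1 : (<<row i X>> <= span_before c)%MS by rewrite genmxE; apply/negbFE.
  by rewrite -IH; apply/eqmx_rank/eqmxP/addsmx_idPr.
rewrite cardsU1 Si -IH; apply/eqP; rewrite eqn_leq; apply/andP; split.
  apply: leq_trans (mxrank_adds_leqif _ _).1 _; rewrite leq_add2r.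
  by rewrite genmxE rank_rV; case: eqP.
suff : (span_before c < <<row i X>> + span_before c)%MS.
  by rewrite ltmxErank => /andP[].
by rewrite ltmxE addsmxSr addsmx_sub genmxE (negbTE pi).
Qed.

Lemma rank_pivots : \rank X = #|pivot_rows|.
Proof.
pose c := (\max_i N i).+1.
have ltc i : (N i < c)%N by rewrite ltnS leq_bigmax.
have -> : #|pivot_rows| = #|[set i in pivot_rows | (N i < c)%N]|.
  by apply: eq_card => i; rewrite !inE ltc andbT.
rewrite -rank_span_before; apply/eqmx_rank/andP; split.
  by apply/row_subP => i; apply: row_sub_span_before.
by apply: span_before_sub => i _; exact: row_sub.
Qed.

End PivotRows.

(** * Rank and nonvanishing minors *)

Lemma enum_val_ord_homo n (S : {set 'I_n}) :
  {homo (fun i : 'I_#|S| => enum_val i) : i j / (i < j)%N}.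
Proof.
move=> i j lij; have x0 : 'I_n := enum_val i.
rewrite !(enum_val_nth x0).
have : sorted ltn (map val (enum S)).
  rewrite sorted_map /enum_mem; apply: sorted_filter.
    by move=> y x z; exact: ltn_trans.
  by rewrite -enumT -sorted_map val_enum_ord iota_ltn_sorted.
move=> so; rewrite -!(nth_map x0 0%N val) -?cardE //.
by apply: (sorted_ltn_nth ltn_trans 0%N so) lij; rewrite inE size_map -cardE.
Qed.

(* The pivots for the natural order of the rows. *)
Lemma increasing_free_rows (F : fieldType) m n (A : 'M[F]_(m, n)) r :
  (r <= \rank A)%N ->
  exists f : 'I_r -> 'I_m,
    {homo f : i j / (i < j)%N} /\ row_free (rowsub f A).
Proof.
pose N : 'I_m -> nat := val; have Ni : injective N := val_inj.
pose S := pivot_rows A N.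
have rS : \rank A = #|S| by exact: rank_pivots.
rewrite rS => ler.
have hh := @enum_val_ord_homo _ S.
pose f0 : 'I_#|S| -> 'I_m := enum_val.
have fr0 : row_free (rowsub f0 A).
  rewrite /row_free eqn_leq rank_leq_row /=.
  have /leq_trans : (#|S| <= \rank A)%N by rewrite rS.
  apply.
  apply: mxrankS; apply: (@sub_pivot_rowsub _ _ _ A N) => j jS.
  by exists (enum_rank_in jS j); rewrite /f0 enum_rankK_in.
exists (f0 \o widen_ord ler); split.
  by move=> i j lij; exact: (hh (widen_ord ler i) (widen_ord ler j)).
(* A relation among the first [r] pivots, padded with zeros, is a relation among all of them. *)
apply: inj_row_free => v hv.
suff : v *m rowsub (widen_ord ler) 1%:M = 0.
  move=> h; apply/rowP => i; rewrite mxE.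
  have := congr1 (fun w : 'rV_ _ => w 0 (widen_ord ler i)) h.
  rewrite !mxE (bigD1 i) //= !mxE eqxx mulr1 big1 ?addr0 // => j ji.
  rewrite !mxE (_ : (_ == _) = false) ?mulr0 //.
  by apply/negbTE; apply: contra ji => /eqP /(congr1 val) /= /val_inj ->.
apply: (row_free_inj fr0); rewrite mul0mx -mulmxA mul_rowsub_mx mul1mx.
by rewrite -rowsub_comp.
Qed.

(** Independent rows are selected first, then independent columns of the resulting submatrix, by
    passing to the transpose. *)
Lemma rank_minor (F : fieldType) m n (A : 'M[F]_(m, n)) r :
  (r <= \rank A)%N ->
  exists (f : 'I_r -> 'I_m) (g : 'I_r -> 'I_n),
    [/\ {homo f : i j / (i < j)%N}, {homo g : i j / (i < j)%N} &
      \det (mxsub f g A) != 0].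
Proof.
move=> /increasing_free_rows[f [fi ff]].
have : (r <= \rank (rowsub f A)^T)%N by rewrite mxrank_tr; move/eqP: ff => ->.
move=> /increasing_free_rows[g [gi gf]]; exists f, g; split => //.
rewrite -unitfE -[_ \is a _]/(_ \in unitmx) -unitmx_tr -row_free_unit.
by congr row_free: gf; apply/matrixP => i j; rewrite !mxE.
Qed.

Lemma minor_rank (F : fieldType) m n (A : 'M[F]_(m, n)) r
    (f : 'I_r -> 'I_m) (g : 'I_r -> 'I_n) :
  \det (mxsub f g A) != 0 -> (r <= \rank A)%N.
Proof.
rewrite -unitfE -[_ \is a _]/(_ \in unitmx) => /mxrank_unit rk.
rewrite -{1}rk.
have -> : mxsub f g A = rowsub f 1%:M *m A *m colsub g 1%:M.
  by rewrite mul_rowsub_mx mul1mx mulmx_colsub mulmx1; apply/matrixP=> i j; rewrite !mxE.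
by apply: leq_trans (mxrankM_maxl _ _) _; exact: mxrankM_maxr.
Qed.

(** * Multi-indices and down-closed sets *)

Section MultiIndices.
Variables d m : nat.

Definition mexp (i : 'I_(nd d m)) (j : 'I_d) : nat := tnth (multi_index i) j.

Definition mdeg (i : 'I_(nd d m)) : nat := (\sum_j mexp i j)%N.

Lemma mdegE i : mdeg i = (\sum_(x <- multi_index i) x)%N.
Proof. by rewrite [RHS]big_tuple. Qed.

Lemma mdeg_bounds i : (1 <= mdeg i <= m)%N.
Proof.
rewrite mdegE.
by have := enum_valP (cast_ord (esym (card_multi_indices d m)) i); rewrite inE.
Qed.

Lemma leq_mexp i j : (mexp i j <= m)%N.
Proof. by rewrite -ltnS ltn_ord. Qed.

Lemma mexp_inj i i' : mexp i =1 mexp i' -> i = i'.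
Proof.
move=> e; have /enum_val_inj/cast_ord_inj // : multi_index i = multi_index i'.
by apply: eq_from_tnth => j; apply/val_inj/e.
Qed.

Lemma mexp_surj (a : 'I_d -> nat) :
  (1 <= \sum_j a j <= m)%N -> exists i, mexp i =1 a.
Proof.
move=> /andP[a_gt0 a_le].
have lea j : (a j < m.+1)%N.
  by rewrite ltnS; apply: leq_trans a_le; rewrite (bigD1 j) //= leq_addr.
pose t : d.-tuple 'I_m.+1 := [tuple Ordinal (lea j) | j < d].
have tP : t \in multi_indices d m.
  by rewrite inE big_tuple; under eq_bigr do rewrite tnth_mktuple /=; rewrite a_gt0.
exists (cast_ord (card_multi_indices d m) (enum_rank_in tP t)) => j.
by rewrite /mexp /multi_index cast_ordK enum_rankK_in // tnth_mktuple.
Qed.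

(** A relation, not a function: degree [m] has no successors, and degree 1 has no predecessors
    because zero is excluded. *)
Definition succ_at (j : 'I_d) (a b : 'I_(nd d m)) : bool :=
  [forall j', mexp b j' == (mexp a j' + (j' == j))%N].

Lemma succ_atP j a b :
  reflect (forall j', mexp b j' = (mexp a j' + (j' == j))%N) (succ_at j a b).
Proof. by apply: (iffP forallP) => h j'; apply/eqP; exact: h. Qed.

Lemma sum_eq_ord (j : 'I_d) : (\sum_(j' < d) (j' == j))%N = 1%N.
Proof. by rewrite (bigD1 j) //= eqxx big1 ?addn0 // => j' /negbTE ->. Qed.

Lemma mdeg_succ j a b : succ_at j a b -> mdeg b = (mdeg a).+1.
Proof.
move=> /succ_atP ab; rewrite /mdeg; under eq_bigr do rewrite ab.
by rewrite big_split /= sum_eq_ord addn1.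
Qed.

Lemma succ_at_inj j a b b' : succ_at j a b -> succ_at j a b' -> b = b'.
Proof.
by move=> /succ_atP ab /succ_atP ab'; apply: mexp_inj => j'; rewrite ab ab'.
Qed.

Lemma ex_succ_at j a : (mdeg a < m)%N -> exists b, succ_at j a b.
Proof.
move=> lt; have [|b hb] := @mexp_surj (fun j' => mexp a j' + (j' == j))%N.
  by rewrite big_split /= sum_eq_ord addn1.
by exists b; apply/succ_atP.
Qed.

Lemma ex_pred_at j b :
  (0 < mexp b j)%N -> (1 < mdeg b)%N -> exists a, succ_at j a b.
Proof.
move=> b_gt0 lt.
have e j' : (mexp b j' - (j' == j) + (j' == j))%N = mexp b j'.
  by rewrite subnK //; case: eqVneq => // ->.
have [|a ha] := @mexp_surj (fun j' => mexp b j' - (j' == j))%N.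
  have /andP[_ le] := mdeg_bounds b.
  have : (\sum_j' (mexp b j' - (j' == j)) + 1)%N = mdeg b.
    by rewrite -(sum_eq_ord j) -big_split; apply: eq_bigr => j' _; exact: e.
  by rewrite addn1 => eb; rewrite -ltnS eb lt /= ltnW // eb.
by exists a; apply/succ_atP => j'; rewrite ha e.
Qed.

Definition down_closed (T : {set 'I_(nd d m)}) : Prop :=
  forall j a b, succ_at j a b -> b \in T -> a \in T.

Definition level (T : {set 'I_(nd d m)}) (i : nat) : {set 'I_(nd d m)} :=
  [set a in T | mdeg a == i].

(** Lowering the [j]-th exponent maps the elements of level [i.+1] that involve [j] injectively into
    level [i]. *)
Lemma level_sum_succ (T : {set 'I_(nd d m)}) i j : down_closed T -> (0 < i)%N ->
  (\sum_(b in level T i.+1) mexp b j <= \sum_(a in level T i) (mexp a j).+1)%N.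
Proof.
move=> dT i_gt0.
(* The default [b] is never taken on the set [A] below, where a predecessor exists. *)
pose phi b := odflt b [pick a | succ_at j a b].
have phiP b : b \in level T i.+1 -> (0 < mexp b j)%N -> succ_at j (phi b) b.
  rewrite inE => /andP[_ /eqP db] bj; rewrite /phi.
  have [|a ab] := ex_pred_at bj; first by rewrite db.
  by case: pickP => [//|/(_ a)]; rewrite ab.
pose A := [set b in level T i.+1 | (0 < mexp b j)%N].
have phiA b : b \in A -> succ_at j (phi b) b.
  by rewrite inE => /andP[]; exact: phiP.
rewrite (bigID (fun b => (0 < mexp b j)%N)) /= [X in (_ + X)%N]big1 => [|b /andP[_]];
  last by rewrite -eqn0Ngt => /eqP.
rewrite addn0 (eq_bigl (fun b => b \in A)) => [|b]; last by rewrite [RHS]inE.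
rewrite [leqLHS](eq_bigr (fun b => (mexp (phi b) j).+1)); last first.
  by move=> b bA; have /succ_atP -> := phiA b bA; rewrite eqxx addn1.
rewrite -(big_imset (fun a => (mexp a j).+1)) /=; last first.
  by move=> b b' /phiA pb /phiA pb' e; apply: succ_at_inj pb _; rewrite e.
rewrite [X in (_ <= X)%N](bigID (mem (phi @: A))) /=.
apply: leq_trans (leq_addr _ _); apply: eq_leq; apply: eq_bigl => a.
apply/idP/andP => [|[]//] aA; split => //.
case/imsetP: aA => b bA ->; have pb := phiA _ bA.
move: bA; rewrite !inE -andbA (mdeg_succ pb) eqSS => /and3P[bT -> _].
by rewrite andbT; exact: dT pb bT.
Qed.

(** Double counting of the exponents in level [i.+1]: they total [i.+1] per element, and after
    lowering, each [a] of level [i] accounts for at most the sum of [mexp a j + 1] over [J], hence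
    at most [i + #|J|]. *)
Lemma level_succ_le (T : {set 'I_(nd d m)}) (J : {set 'I_d}) i :
    down_closed T -> (0 < i)%N ->
    (forall b j, b \in level T i.+1 -> (0 < mexp b j)%N -> j \in J) ->
  (i.+1 * #|level T i.+1| <= (i + #|J|) * #|level T i|)%N.
Proof.
move=> dT i_gt0 hJ.
have -> : (i.+1 * #|level T i.+1| = \sum_(b in level T i.+1) mdeg b)%N.
  have e b : b \in level T i.+1 -> mdeg b = i.+1 by rewrite inE => /andP[_ /eqP].
  by rewrite [RHS](eq_bigr _ e) sum_nat_const mulnC.
rewrite exchange_big /= (bigID (mem J)) /= [X in (_ + X)%N]big1 ?addn0; last first.
  move=> j jJ; apply: big1 => b bT; apply/eqP; rewrite -leqn0 leqNgt.
  by apply: contra jJ; exact: hJ.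
apply: (@leq_trans (\sum_(j in J) \sum_(a in level T i) (mexp a j).+1)%N).
  by apply: leq_sum => j _; exact: level_sum_succ.
rewrite exchange_big /= mulnC -sum_nat_const; apply: leq_sum => a.
rewrite inE => /andP[_ /eqP <-].
under eq_bigr do rewrite -addn1.
rewrite big_split /= sum1_card leq_add2r /mdeg.
by rewrite [X in (_ <= X)%N](bigID (mem J)) /= leq_addr.
Qed.

Lemma level1_exp a j : mdeg a = 1%N -> (0 < mexp a j)%N ->
  forall j', mexp a j' = (j' == j).
Proof.
move=> da aj j'; move: da; rewrite /mdeg (bigD1 j) //=.
case e: (mexp a j) aj => [//|n] _.
rewrite addSn => -[] /eqP; rewrite addn_eq0 sum_nat_eq0 => /andP[/eqP n0 /forallP h].
by case: eqVneq => [->|ne]; [rewrite e n0|apply/eqP; have /implyP := h j'; apply].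
Qed.

(** A multi-index of degree 1 involves a single variable, so distinct variables have distinct
    witnesses. *)
Lemma card_level1_le (T : {set 'I_(nd d m)}) (J : {set 'I_d}) :
    (forall j, j \in J -> exists2 a, a \in level T 1 & (0 < mexp a j)%N) ->
  (#|J| <= #|level T 1|)%N.
Proof.
move=> hJ.
pose f j := [pick a in level T 1 | (0 < mexp a j)%N].
have fP j : j \in J -> exists a, [/\ f j = Some a, a \in level T 1 & (0 < mexp a j)%N].
  move=> /hJ[a aT aj]; rewrite /f; case: pickP => [b /andP[bT bj]|/(_ a)].
    by exists b.
  by rewrite aT aj.
have finj : {in J &, injective f}.
  move=> j j' /fP[a [-> aT aj]] /fP[a' [-> _ aj']] [ea]; subst a'.
  move: aT; rewrite inE => /andP[_ /eqP da].
  by have := level1_exp da aj' j; move: aj; case: (mexp a j) => // n _; case: eqVneq.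
have : (#|f @: J| <= #|Some @: level T 1|)%N.
  apply: subset_leq_card; apply/fintype.subsetP => x /imsetP[j /fP[a [e aT _]] ->].
  by rewrite e; apply: imset_f.
by rewrite (card_in_imset finj) (card_imset _ (@Some_inj _)).
Qed.

(* The support of an element of degree 2 consists of the variables of its two
   predecessors, so a down-closed set only uses the variables of its level 1. *)
Lemma level2_le (T : {set 'I_(nd d m)}) : down_closed T ->
  (2 * #|level T 2| <= (1 + #|level T 1|) * #|level T 1|)%N.
Proof.
move=> dT.
pose J := [set j | [exists a in level T 1, (0 < mexp a j)%N]].
apply: (@leq_trans ((1 + #|J|) * #|level T 1|)%N).
  apply: level_succ_le => // b j; rewrite inE => /andP[bT /eqP db] bj.
  have [|a ab] := ex_pred_at bj; first by rewrite db.
  have da : mdeg a = 1%N by move: (mdeg_succ ab); rewrite db => -[].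
  have aT := dT _ _ _ ab bT.
  rewrite inE; apply/existsP.
  have [aj|aj] := posnP (mexp a j); last by exists a; rewrite inE aT da eqxx.
  (* Here [b] is the product of the distinct variables [j] and [j']; its predecessor along [j'] is
     the variable [j] itself. *)
  have [j' aj'] : exists j', (0 < mexp a j')%N.
    apply/existsP; rewrite -[X in is_true X]negbK negb_exists; apply/negP => /forallP h.
    move: da; rewrite /mdeg big1 // => j' _; apply/eqP.
    by rewrite -leqn0 leqNgt h.
  have bj' : (0 < mexp b j')%N by move/succ_atP: ab => ->; rewrite addn_gt0 aj'.
  have [|c cb] := ex_pred_at bj'; first by rewrite db.
  exists c; rewrite inE (dT _ _ _ cb bT).
  move: (mdeg_succ cb); rewrite db => -[<-] /=.
  move/succ_atP: cb => /(_ j); case: eqVneq => [e|_].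
    by rewrite -e aj in aj'.
  by rewrite addn0 => <-.
rewrite leq_mul2r leq_add2l; apply/orP; right.
by apply: card_level1_le => j; rewrite inE => /existsP[a /andP[aT aj]]; exists a.
Qed.

End MultiIndices.

(** * Counting multi-indices by degree *)

Lemma ex_widen_index d l k : (l <= k)%N ->
  exists f : 'I_(nd d l) -> 'I_(nd d k), forall c, mexp (f c) =1 mexp c.
Proof.
move=> lk.
have h (c : 'I_(nd d l)) : exists a : 'I_(nd d k), mexp a =1 mexp c.
  by apply: mexp_surj; have /andP[-> /leq_trans ->] := mdeg_bounds c.
by exists (fun c => sval (cid (h c))) => c; exact: svalP (cid (h c)).
Qed.

Lemma eq_mdeg d l k (c : 'I_(nd d l)) (a : 'I_(nd d k)) :
  mexp a =1 mexp c -> mdeg a = mdeg c.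
Proof. by move=> e; apply: eq_bigr => j _; exact: e. Qed.

Lemma widen_index_image d l k (f : 'I_(nd d l) -> 'I_(nd d k)) a :
    (forall c, mexp (f c) =1 mexp c) -> (mdeg a <= l)%N ->
  exists c, a = f c.
Proof.
move=> fP al; have [|c ec] := @mexp_surj d l (mexp a).
  by have /andP[+ _] := mdeg_bounds a; rewrite /mdeg => ->.
by exists c; apply: mexp_inj => j; rewrite fP ec.
Qed.

Lemma card_mdeg_le d l k : (l <= k)%N ->
  #|[set a : 'I_(nd d k) | (mdeg a <= l)%N]| = nd d l.
Proof.
move=> lk; have [f fP] := ex_widen_index d lk.
have f_inj : injective f.
  by move=> c c' e; apply: mexp_inj => j; rewrite -!fP e.
rewrite -[RHS]card_ord -(card_imset _ f_inj); apply: eq_card => a.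
rewrite inE; apply/idP/imsetP => [al|[c _ ->]].
  by have [c ->] := widen_index_image fP al; exists c.
by rewrite (eq_mdeg (fP c)); have /andP[] := mdeg_bounds c.
Qed.

Lemma card_mdeg_le_sum d k (T : {set 'I_(nd d k)}) l :
  #|[set a in T | (mdeg a <= l)%N]| = (\sum_(1 <= i < l.+1) #|level T i|)%N.
Proof.
elim: l => [|l IH].
  rewrite big_geq //; apply/eqP; rewrite cards_eq0; apply/eqP/setP => a.
  by have /andP[+ _] := mdeg_bounds a; rewrite !inE lt0n leqn0 => /negbTE ->; rewrite andbF.
rewrite big_nat_recr //= -IH -cardsUI.
rewrite (_ : _ :&: _ = finset.set0).
  rewrite cards0 addn0; apply: eq_card => a; rewrite !inE -andb_orr orbC.
  by rewrite -leq_eqVlt.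
by apply/setP => a; rewrite !inE; case: eqVneq => [->|_]; rewrite ?ltnn ?andbF.
Qed.

(** The difference of two consecutive values of [nd d], by Pascal's rule. *)
Lemma card_level_setT d k i : (0 < d)%N -> (0 < i <= k)%N ->
  #|level [set: 'I_(nd d k)] i| = 'C(d + i.-1, i).
Proof.
move=> d_gt0 /andP[]; case: i => // i _ lik /=.
have e l : [set a in [set: 'I_(nd d k)] | (mdeg a <= l)%N] = [set a | (mdeg a <= l)%N].
  by apply/setP => a; rewrite !inE.
have := card_mdeg_le_sum [set: 'I_(nd d k)] i.+1.
rewrite big_nat_recr //= -card_mdeg_le_sum !e !card_mdeg_le //; last exact: ltnW.
have bin_pos n : (0 < 'C(d + n, n))%N by rewrite bin_gt0 leq_addl.
rewrite /nd => /(congr1 (addn 1)); rewrite addnA !subnKC // addnS binS.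
by rewrite addnC => /addnI <-.
Qed.

(** The full set attains equality in [level_succ_le] with all [d] variables, so densities are
    measured against it. *)
Lemma level_setT_succ d k i : (0 < d)%N -> (0 < i < k)%N ->
  (i.+1 * #|level [set: 'I_(nd d k)] i.+1| =
     (i + d) * #|level [set: 'I_(nd d k)] i|)%N.
Proof.
move=> d_gt0 /andP[i_gt0 ik]; rewrite !card_level_setT // ?i_gt0 1?ltnW //=.
rewrite -mul_bin_diag addnC; congr (_ * 'C(_, _))%N.
by case: i i_gt0 {ik} => // i _; rewrite ?addSn ?addnS ?[(d + _)%N]addnC.
Qed.

(* Cross-multiplied form of: if [h i / c i] is nonincreasing and drops between
   [1] and [k], then its average over [1..l] exceeds that over [1..k]. *)
Lemma average_ratio_lt (h c : nat -> nat) l k : (0 < l < k)%N ->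
    (forall i j, (0 < i)%N -> (i <= j <= k)%N -> (h j * c i <= h i * c j)%N) ->
    (h k * c 1 < h 1 * c k)%N ->
  ((\sum_(1 <= i < k.+1) h i) * (\sum_(1 <= i < l.+1) c i) <
     (\sum_(1 <= i < l.+1) h i) * (\sum_(1 <= i < k.+1) c i))%N.
Proof.
move=> /andP[l_gt0 lk] mono strict.
rewrite (@big_cat_nat _ _ _ l.+1 1 k.+1 _ h) //=; last exact: ltnW.
rewrite (@big_cat_nat _ _ _ l.+1 1 k.+1 _ c) //=; last exact: ltnW.
(* The product of the two sums up to [l] cancels; the tail beyond [l] remains to be compared with
   the head. *)
rewrite mulnDl mulnDr ltn_add2l.
set H := (\sum_(1 <= i < l.+1) h i)%N; set C := (\sum_(1 <= i < l.+1) c i)%N.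
have hj j : (l < j <= k)%N -> (h j * C <= H * c j)%N.
  move=> /andP[lj jk]; rewrite /H /C big_distrr big_distrl /= big_nat [leqRHS]big_nat.
  apply: leq_sum => i /andP[i_gt0 il]; apply: mono => //.
  by rewrite jk andbT; apply: leq_trans (ltnW lj).
(* Strictness comes from the single pair [i = 1], [j = k]. *)
have hk : (h k * C < H * c k)%N.
  rewrite /H /C big_distrr big_distrl /= big_ltn // [ltnRHS]big_ltn //.
  rewrite -addSn leq_add // big_nat [leqRHS]big_nat.
  apply: leq_sum => i /andP[i_gt1 il]; apply: mono => //; first exact: ltnW.
  by rewrite leqnn andbT ltnW //; apply: leq_trans lk.
rewrite big_distrl big_distrr /= big_nat_recr //= [ltnRHS]big_nat_recr //=.
rewrite -addnS leq_add // big_nat [leqRHS]big_nat.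
by apply: leq_sum => j /andP[lj jk]; apply: hj; rewrite lj ltnW.
Qed.

(** * Densities of a down-closed set *)

Section LevelRatios.
Variables (d k : nat) (T : {set 'I_(nd d k)}).
Hypotheses (d_gt0 : (0 < d)%N) (k_gt1 : (1 < k)%N) (dT : down_closed T).

Let h i := #|level T i|.
Let c i := #|level [set: 'I_(nd d k)] i|.

Lemma card_level_setT_gt0 i : (0 < i <= k)%N -> (0 < c i)%N.
Proof.
move=> ik; rewrite /c card_level_setT // bin_gt0.
by case: i ik => // i _; rewrite /= -add1n leq_add.
Qed.

(** From degree [j] to [j.+1] the full level grows by the factor [(j + d) / (j + 1)] exactly, the
    level of [T] by at most that. *)
Lemma level_ratio_mono i j : (0 < i)%N -> (i <= j <= k)%N ->
  (h j * c i <= h i * c j)%N.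
Proof.
move=> i_gt0 /andP[]; elim: j => [|j IH]; first by rewrite leqNgt i_gt0.
rewrite leq_eqVlt => /predU1P[->//|]; rewrite ltnS => ij jk.
have j_gt0 : (0 < j)%N by apply: leq_trans ij.
have {}IH := IH ij (ltnW jk).
have hS : (j.+1 * h j.+1 <= (j + d) * h j)%N.
  rewrite -[X in (j + X)%N](card_ord d) -cardsT.
  by apply: level_succ_le => // *; rewrite inE.
have cS : (j.+1 * c j.+1 = (j + d) * c j)%N by apply: level_setT_succ; rewrite ?j_gt0.
rewrite -(leq_pmul2l (ltn0Sn j)) mulnA [leqRHS]mulnCA cS.
apply: (@leq_trans ((j + d) * h j * c i)%N); first by rewrite leq_mul2r hS orbT.
by rewrite -mulnA [leqRHS]mulnCA leq_mul2l IH orbT.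
Qed.

(** If [T] contains every variable, density 1 in degree [k] would make [T] full. Otherwise [T] uses
    only [h 1 < d] variables, and the density already drops from degree 1 to degree 2. *)
Lemma level_ratio_lt : (0 < #|T| < nd d k)%N -> (h k * c 1 < h 1 * c k)%N.
Proof.
move=> /andP[T_gt0 T_lt].
have k_gt0 := ltnW k_gt1.
have c1 : c 1 = d by rewrite /c card_level_setT ?k_gt0 // addn0 bin1.
have cardT : #|T| = (\sum_(1 <= i < k.+1) h i)%N.
  rewrite -card_mdeg_le_sum; apply: eq_card => a; rewrite !inE.
  by have /andP[_ ->] := mdeg_bounds a; rewrite andbT.
have ndE : nd d k = (\sum_(1 <= i < k.+1) c i)%N.
  rewrite -card_mdeg_le_sum -[LHS](card_ord) -cardsT; apply: eq_card => a.
  by rewrite !inE; have /andP[_ ->] := mdeg_bounds a.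
have h1_le : (h 1 <= c 1)%N.
  by apply: subset_leq_card; apply/fintype.subsetP => a; rewrite !inE => /andP[].
have h1_gt0 : (0 < h 1)%N.
  rewrite lt0n; apply/negP => /eqP h1; move: T_gt0; rewrite cardT.
  rewrite big_nat big1 // => i /andP[i_gt0 ik].
  have := @level_ratio_mono 1 i isT; rewrite i_gt0 -ltnS ik h1 mul0n leqn0 muln_eq0.
  by move=> /(_ isT); rewrite c1 (gtn_eqF d_gt0) orbF => /eqP.
have ck : (0 < c k)%N by apply: card_level_setT_gt0; rewrite k_gt0 /=.
have c2_gt0 : (0 < c 2)%N by apply: card_level_setT_gt0.
have [h1|h1] : h 1 = c 1 \/ (h 1 < d)%N.
- by move: h1_le; rewrite leq_eqVlt c1 => /predU1P[]; [left|right].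
- rewrite h1 mulnC ltn_pmul2l ?c1 // ltnNge; apply/negP => ckh.
  move: T_lt; rewrite cardT ndE ltnNge => /negP; apply.
  rewrite big_nat [leqRHS]big_nat; apply: leq_sum => i /andP[i_gt0 ik].
  rewrite -(leq_pmul2r ck); apply: leq_trans (level_ratio_mono i_gt0 _).
    by rewrite mulnC leq_mul2r ckh orbT.
  by rewrite leqnn -ltnS ik.
have h2 : (h 2 * c 1 < h 1 * c 2)%N.
  rewrite -(ltn_pmul2l (isT : (0 < 2)%N)) [ltnRHS]mulnCA.
  have -> : (2 * c 2 = (1 + d) * c 1)%N by apply: level_setT_succ; rewrite //= k_gt1.
  rewrite c1 !mulnA ltn_pmul2r //.
  apply: leq_ltn_trans (level2_le dT) _.
  by rewrite mulnC ltn_pmul2l // ltn_add2l.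
rewrite -(ltn_pmul2r c2_gt0).
apply: (@leq_ltn_trans (h 2 * c k * c 1)%N).
  by rewrite mulnAC leq_mul2r level_ratio_mono ?orbT // k_gt1 /=.
by rewrite mulnAC [ltnRHS]mulnAC ltn_pmul2r.
Qed.

Lemma down_closed_density_lt l : (0 < l < k)%N -> (0 < #|T| < nd d k)%N ->
  (#|T| * nd d l < #|[set a in T | (mdeg a <= l)%N]| * nd d k)%N.
Proof.
move=> lk Tk.
have := average_ratio_lt lk level_ratio_mono (level_ratio_lt Tk).
rewrite -!card_mdeg_le_sum.
have e i : (i <= k)%N ->
    #|[set a in [set: 'I_(nd d k)] | (mdeg a <= i)%N]| = nd d i.
  by move=> ik; rewrite -(card_mdeg_le d ik); apply: eq_card => a; rewrite !inE.
rewrite !e //; last by case/andP: lk => _ /ltnW.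
congr (_ * _ < _)%N; apply: eq_card => a; rewrite !inE.
by have /andP[_ ->] := mdeg_bounds a; rewrite andbT.
Qed.

End LevelRatios.

(** * Weights giving an additive graded order *)

Lemma digits_lt B d (a : 'I_d -> nat) : (forall j, (a j < B)%N) ->
  (\sum_j a j * B ^ j < B ^ d)%N.
Proof.
elim: d a => [|d IH] a aB; first by rewrite big_ord0.
rewrite big_ord_recr /= expnS.
have := IH (a \o widen_ord (leqnSn d)) (fun j => aB _) => /= lt.
apply: (@leq_trans (B ^ d + a ord_max * B ^ d)%N); first by rewrite ltn_add2r.
by rewrite -mulSn leq_mul2r aB orbT.
Qed.

Lemma digits_inj B d (a b : 'I_d -> nat) :
    (forall j, (a j < B)%N) -> (forall j, (b j < B)%N) ->
  (\sum_j a j * B ^ j = \sum_j b j * B ^ j)%N -> a =1 b.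
Proof.
elim: d a b => [|d IH] a b aB bB; first by move=> _ [].
have B_gt0 : (0 < B)%N by apply: leq_ltn_trans (aB ord0).
rewrite !big_ord_recl /= !muln1.
have shift (c : 'I_d.+1 -> nat) :
    (\sum_(i < d) c (lift ord0 i) * B ^ bump 0 i =
     (\sum_(i < d) c (lift ord0 i) * B ^ i) * B)%N.
  rewrite big_distrl /=; apply: eq_bigr => i _.
  by rewrite /bump add1n expnSr mulnA.
rewrite !shift => e.
have e0 : a ord0 = b ord0.
  by have := congr1 (modn^~ B) e; rewrite /= -modnDmr modnMl addn0 -[in RHS]modnDmr modnMl addn0 !modn_small.
have {}e : (\sum_(i < d) a (lift ord0 i) * B ^ i =
            \sum_(i < d) b (lift ord0 i) * B ^ i)%N.
  by move: e; rewrite e0 => /addnI/eqP; rewrite eqn_pmul2r // => /eqP.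
have eS := IH (a \o lift ord0) (b \o lift ord0) (fun j => aB _) (fun j => bB _) e.
by move=> j; case: (unliftP ord0 j) => [i ->|->] //; exact: eS.
Qed.

Section Weights.
Variables d k : nat.
Implicit Types (a b : 'I_(nd d k)) (j : 'I_d).

(** The first term makes [key] compare degrees first; the second records the exponents as digits in
    base [k.+1]. *)
Definition weight j : nat := (k.+1 ^ d + k.+1 ^ j)%N.

Definition key a : nat := (\sum_j mexp a j * weight j)%N.

Lemma keyE a : key a = (mdeg a * k.+1 ^ d + \sum_j mexp a j * k.+1 ^ j)%N.
Proof.
rewrite /key /mdeg big_distrl -big_split /=.
by apply: eq_bigr => j _; rewrite mulnDr.
Qed.

Lemma key_digits_lt a : (\sum_j mexp a j * k.+1 ^ j < k.+1 ^ d)%N.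
Proof. by apply: digits_lt => j; rewrite ltnS leq_mexp. Qed.

Lemma key_inj : injective key.
Proof.
move=> a b; rewrite !keyE => /(congr1 (modn^~ (k.+1 ^ d)%N)).
rewrite !modnMDl !modn_small ?key_digits_lt // => e.
by apply: mexp_inj; apply: digits_inj e => j; rewrite ltnS leq_mexp.
Qed.

(** The degree is the quotient of [key a] by [k.+1 ^ d], so degree bounds cut out initial
    segments. *)
Lemma ltn_key_mdeg l a : (key a < l.+1 * k.+1 ^ d)%N = (mdeg a <= l)%N.
Proof.
rewrite keyE -ltn_divLR ?expn_gt0 // divnMDl ?expn_gt0 //.
by rewrite divn_small ?key_digits_lt // addn0.
Qed.

Lemma key_lt_mdeg a b : (key a < key b)%N -> (mdeg a <= mdeg b)%N.
Proof.
move=> /leq_trans; rewrite -ltn_key_mdeg; apply.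
by rewrite ltnW // ltn_key_mdeg.
Qed.

Lemma key_succ j a b : succ_at j a b -> key b = (key a + weight j)%N.
Proof.
move=> /succ_atP ab; rewrite /key; under eq_bigr do rewrite ab mulnDl.
rewrite big_split /=; congr (_ + _)%N.
by rewrite (bigD1 j) //= eqxx mul1n big1 ?addn0 // => j' /negbTE ->.
Qed.

End Weights.

(** * The falling factorial matrix and its pivots *)

Section FallingFactorials.
Variable R : numFieldType.

Definition ffact_mx (d k l : nat) : 'M[R]_(nd d k, nd d l) :=
  \matrix_(a, b) \prod_j ((mexp a j) ^_ (mexp b j))%:R.

Lemma ffact_mx_diag d k (a : 'I_(nd d k)) : ffact_mx d k k a a != 0.
Proof.
rewrite mxE; apply/prodf_neq0 => j _.
by rewrite ffactnn pnatr_eq0 -lt0n fact_gt0.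
Qed.

Lemma ffact_mx_key d k (a b : 'I_(nd d k)) :
  ffact_mx d k k a b != 0 -> (key b <= key a)%N.
Proof.
rewrite mxE => /prodf_neq0 h; apply: leq_sum => j _.
rewrite leq_mul2r; apply/orP; right.
by have := h j isT; rewrite pnatr_eq0 -lt0n ffact_gt0.
Qed.

(** The matrix is triangular for [key] with nonzero diagonal. *)
Lemma ffact_mx_unit d k : ffact_mx d k k \in unitmx.
Proof.
rewrite -unitmx_tr -row_free_unit; apply: inj_row_free => u hu.
suff u0 c a : (key a < c)%N -> u 0 a = 0.
  by apply/rowP => a; rewrite mxE; exact: u0 (ltnSn _).
elim: c a => // c IH a; rewrite ltnS leq_eqVlt => /predU1P[ac|]; last exact: IH.
have := congr1 (fun w : 'rV_ _ => w 0 a) hu; rewrite !mxE (bigD1 a) //=.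
rewrite big1 ?addr0 => [/eqP|b ba].
  by rewrite mulf_eq0 mxE (negbTE (ffact_mx_diag a)) orbF => /eqP.
rewrite [_^T _ _]mxE; have [->|fab] := eqVneq (ffact_mx d k k a b) 0.
  by rewrite mulr0.
rewrite IH ?mul0r // -ac ltn_neqAle ffact_mx_key // andbT.
by apply: contra ba => /eqP/key_inj ->.
Qed.

Lemma rowsub1_free m n (p : 'I_m -> 'I_n) :
  injective p -> row_free (rowsub p 1%:M : 'M[R]_(m, n)).
Proof.
move=> p_inj; apply: inj_row_free => v hv; apply/rowP => i.
have := congr1 (fun w : 'rV_ _ => w 0 (p i)) hv; rewrite !mxE (bigD1 i) //=.
rewrite !mxE eqxx mulr1 big1 ?addr0 // => j ji.
by rewrite !mxE (inj_eq p_inj) (negbTE ji) mulr0.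
Qed.

Variables (d k m : nat) (p : 'I_m -> 'I_(nd d k)).

Let X := (rowsub p (ffact_mx d k k))^T.

Lemma rank_ffact_rowsub : injective p -> \rank X = m.
Proof.
move=> p_inj; rewrite mxrank_tr -[ffact_mx d k k]mul1mx -mul_rowsub_mx.
rewrite mxrankMfree ?row_free_unit ?ffact_mx_unit //.
exact/eqP/rowsub1_free.
Qed.

(* Multiplying a column by the function [x_j - b_j] shifts the index [b] of a
   falling factorial by one, so linear relations propagate upwards. *)
Lemma ffact_row_shift j (b c c' : 'I_(nd d k)) : succ_at j c c' ->
  row c X *m diag_mx (\row_i ((mexp (p i) j)%:R - (mexp b j)%:R)) =
  row c' X + ((mexp c j)%:R - (mexp b j)%:R) *: row c X.
Proof.
move=> /succ_atP cc'; apply/rowP => i; rewrite mul_mx_diag !mxE.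
set f := \prod_j0 _; set g := \prod_j0 _.
suff -> : g = f * ((mexp (p i) j)%:R - (mexp c j)%:R) by ring.
rewrite /f /g (bigD1 j) //= [in RHS](bigD1 j) //= mulrAC; congr (_ * _).
  rewrite cc' eqxx addn1 ffactnSr natrM.
  (* When the natural-number subtraction truncates, the falling factorial in front of it is zero. *)
  have [le|lt] := leqP (mexp c j) (mexp (p i) j); first by rewrite natrB.
  by rewrite ffact_small // !mul0r.
by apply: eq_bigr => j' /negbTE jj'; rewrite cc' jj' addn0.
Qed.

(** If row [b] depends on rows [c] of smaller key, multiplication by [x_j - b_j] turns it into row
    [b'], and each row [c] into a combination of rows [c] and [c']. Both still precede [b'], since
    [key] shifts by the same weight. *)
Lemma ffact_pivots_down_closed : down_closed (pivot_rows X (@key d k)).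
Proof.
move=> j b b' bb'; rewrite !inE; apply: contra => rb.
have shift := ffact_row_shift b bb'.
rewrite subrr scale0r addr0 in shift.
rewrite -shift; apply: submx_trans (submxMr _ rb) _.
rewrite /span_before sumsmxMr; apply/sumsmx_subP => c cb.
rewrite (eqmxMr _ (genmxE _)).
have /andP[_ b'k] := mdeg_bounds b'.
(* The order being graded, [c] has degree at most that of [b], which is below [k]; so the successor
   exists. *)
have [|c' cc'] := @ex_succ_at d k j c.
  by apply: leq_ltn_trans (key_lt_mdeg cb) _; rewrite -(mdeg_succ bb').
rewrite (ffact_row_shift b cc') addmx_sub ?scalemx_sub //;
  apply: row_sub_span_before; rewrite ?(key_succ bb') ?(key_succ cc').
  by rewrite ltn_add2r.
exact: ltn_addr.
Qed.

(** These pivots are counted by the rank of an initial segment of rows of [X], which are columns of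
    the matrix on the right. *)
Lemma card_ffact_pivots_le l : (l <= k)%N ->
  (#|[set a in pivot_rows X (@key d k) | (mdeg a <= l)%N]| <=
     \rank (rowsub p (ffact_mx d k l)))%N.
Proof.
move=> lk; have [f fP] := ex_widen_index d lk.
have -> : #|[set a in pivot_rows X (@key d k) | (mdeg a <= l)%N]| =
    \rank (span_before X (@key d k) (l.+1 * k.+1 ^ d)).
  rewrite rank_span_before; last exact: key_inj.
  by apply: eq_card => a; rewrite [LHS]inE [RHS]inE ltn_key_mdeg.
rewrite -[leqRHS]mxrank_tr; apply: mxrankS; apply: span_before_sub => a.
rewrite ltn_key_mdeg => /(widen_index_image fP)[c ->].
suff -> : row (f c) X = row c (rowsub p (ffact_mx d k l))^T by exact: row_sub.
by apply/rowP => i; rewrite !mxE; apply: eq_bigr => j _; rewrite fP.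
Qed.

End FallingFactorials.

Lemma rank_ffact_rowsub_gt (R : numFieldType) d k l m (p : 'I_m -> 'I_(nd d k)) :
    (0 < d)%N -> (0 < l < k)%N -> (0 < m < nd d k)%N -> injective p ->
  (m * nd d l < \rank (rowsub p (ffact_mx R d k l)) * nd d k)%N.
Proof.
move=> d_gt0 lk mk p_inj; have /andP[l_gt0 /ltnW lek] := lk.
set T := pivot_rows (rowsub p (ffact_mx R d k k))^T (@key d k).
have cT : #|T| = m.
  by rewrite -(rank_ffact_rowsub R p_inj) (rank_pivots _ (@key_inj d k)).
have k_gt1 : (1 < k)%N by case/andP: lk; exact: leq_ltn_trans.
have := @down_closed_density_lt d k T d_gt0 k_gt1 (@ffact_pivots_down_closed R d k m p) l lk.
rewrite cT => /(_ mk) /leq_trans; apply.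
by rewrite leq_mul2r card_ffact_pivots_le ?orbT.
Qed.

(** * Echelon form and degeneration *)

(** The pivot columns of [A] are normalised to the identity; every column is a combination of pivot
    columns not ranked after it. *)
Lemma ex_echelon (F : fieldType) m n (A : 'M[F]_(m, n)) (N : 'I_n -> nat) :
    injective N -> row_free A ->
  exists (p : 'I_m -> 'I_n) (B : 'M[F]_m) (E : 'M[F]_(m, n)),
    [/\ injective p, B \in unitmx, A = B *m E,
        forall i i', E i (p i') = (i == i')%:R &
        forall i a, E i a != 0 -> (N (p i) <= N a)%N].
Proof.
move=> N_inj freeA; pose X := A^T; pose S := pivot_rows X N.
have cS : #|S| = m.
  by rewrite -(rank_pivots _ N_inj) mxrank_tr; apply/eqP.
pose p (i : 'I_m) : 'I_n := enum_val (cast_ord (esym cS) i).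
have p_inj : injective p by move=> i i' /enum_val_inj/cast_ord_inj.
have p_surj a : a \in S -> exists i, a = p i.
  move=> aS; exists (cast_ord cS (enum_rank_in aS a)).
  by rewrite /p cast_ordK enum_rankK_in.
have unitXS : rowsub p X \in unitmx.
  rewrite -row_full_unit /row_full eqn_leq rank_leq_col /=.
  have /eqP {1}<- := freeA; rewrite -mxrank_tr; apply: mxrankS.
  exact: sub_pivot_rowsub p_surj.
pose E := (X *m invmx (rowsub p X))^T.
have rowE i : row (p i) E^T = delta_mx 0 i.
  by rewrite trmxK row_mul -row_rowsub -row_mul mulmxV // row1.
have EE i i' : E i (p i') = (i == i')%:R.
  have := congr1 (fun w : 'rV_ _ => w 0 i) (rowE i').
  by rewrite [LHS]mxE [LHS]mxE => ->; rewrite mxE eqxx.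
exists p, (rowsub p X)^T, E; split => //; first by rewrite unitmx_tr.
  by rewrite -trmx_mul mulmxKV // trmxK.
move=> i a; apply: contraNT; rewrite -ltnNge => lt.
(* Vanishing of coordinate [i] is written as containment in a kernel, which can be checked on each
   pivot row of the sum. *)
have : (row a E^T <= kermx (delta_mx i (0 : 'I_1)))%MS.
  rewrite trmxK row_mul.
  have : (row a X <= span_before X N (N a).+1)%MS by exact: row_sub_span_before.
  move=> /submx_trans/(_ (span_before_pivots X N _)) /(submxMr (invmx (rowsub p X))).
  move/submx_trans; apply; rewrite sumsmxMr; apply/sumsmx_subP => b /andP[ba bS].
  rewrite (eqmxMr _ (genmxE _)) -row_mul -[X in row b X]trmxK -/E.
  have [i' eb] := p_surj b bS; rewrite eb rowE; apply/sub_kermxP.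
  rewrite mul_delta_mx_cond (_ : i' == i = false) ?mulr0n //.
  apply/negbTE/eqP => ei; move: ba; rewrite eb ei ltnS => /(leq_trans lt).
  by rewrite ltnn.
move/sub_kermxP/(congr1 (fun w : 'M[F]_1 => w 0 0)).
by rewrite -colE !mxE => ->.
Qed.

(** The [size q] distinct points [1 / (i + 1)] cannot all be roots. *)
Lemma ex_nonroot01 (R : numFieldType) (q : {poly R}) :
  q != 0 -> exists s : R, [/\ 0 < s, s <= 1 & q.[s] != 0].
Proof.
move=> q0.
pose rs := [seq (i.+1%:R)^-1 : R | i <- iota 0 (size q)].
have urs : uniq rs.
  rewrite map_inj_uniq ?iota_uniq // => i i' /invr_inj/eqP.
  by rewrite eqr_nat eqSS => /eqP.
have : ~~ all (root q) rs.
  apply/negP => ar; have := max_poly_roots q0 ar urs.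
  by rewrite size_map size_iota ltnn.
case/allPn => s /mapP[i _ ->] nr; exists (i.+1%:R)^-1; split => //.
by rewrite invf_le1 ?ltr0n // ler1n.
Qed.

(* As [s] tends to 0, the row space of [A diag(s^N)] tends to the coordinate
   space of the pivot columns of [A] in the order [N]. *)
Lemma ex_degeneration (R : numFieldType) m n q (A : 'M[R]_(m, n))
    (G : 'M[R]_(n, q)) (N : 'I_n -> nat) :
    injective N -> row_free A ->
  exists2 p : 'I_m -> 'I_n, injective p &
    exists s : R, [/\ 0 < s, s <= 1 &
      (\rank (rowsub p G) <= \rank (A *m diag_mx (\row_a s ^+ N a) *m G))%N].
Proof.
move=> N_inj /(ex_echelon N_inj)[p [B [E [p_inj Bu -> Ep Elow]]]].
exists p => //.
have [f [g [_ _ fg]]] := rank_minor (leqnn (\rank (rowsub p G))).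
(* Row [i] of [E diag(s^N)] divided by [s ^+ N (p i)]. The division is exact because [E i a]
   vanishes when [N a < N (p i)], and at 0 only column [p i] survives. *)
pose C := \matrix_(i < m, a < n) ((E i a)%:P * 'X^(N a - N (p i))) : 'M[{poly R}]_(m, n).
pose Q := \det (mxsub f g (C *m map_mx polyC G)).
have QE s : Q.[s] = \det (mxsub f g (map_mx (horner_eval s) C *m G)).
  rewrite -[LHS]/(horner_eval s Q) -det_map_mx map_mxsub map_mxM.
  congr (\det (mxsub f g (_ *m _))).
  by apply/matrixP => a b; rewrite !mxE /= /horner_eval hornerC.
have CE s i a : map_mx (horner_eval s) C i a = E i a * s ^+ (N a - N (p i)).
  by rewrite !mxE /horner_eval hornerM hornerC hornerXn.
have Q0 : Q.[0] != 0.
  rewrite QE; suff -> : map_mx (horner_eval 0) C = rowsub p 1%:M.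
    by rewrite mul_rowsub_mx mul1mx.
  apply/matrixP => i a; rewrite CE !mxE.
  case: (eqVneq (p i) a) => [<-|pa]; first by rewrite Ep eqxx subnn mulr1.
  have [->|/Elow le] := eqVneq (E i a) 0; first by rewrite mul0r.
  rewrite expr0n subn_eq0 leqNgt ltn_neqAle le andbT.
  by rewrite (inj_eq N_inj) pa /= mulr0.
have [|s [s_gt0 s_le1 Qs]] := @ex_nonroot01 _ Q.
  by apply: contraNneq Q0 => ->; rewrite horner0.
exists s; split => //.
rewrite QE in Qs; apply: leq_trans (minor_rank Qs) _.
have -> : B *m E *m diag_mx (\row_a s ^+ N a) *m G =
    B *m diag_mx (\row_i s ^+ N (p i)) *m (map_mx (horner_eval s) C *m G).
  rewrite -!mulmxA; congr (B *m _); rewrite !mulmxA; congr (_ *m G).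
  apply/matrixP => i a; rewrite mul_mx_diag mul_diag_mx mxE [RHS]mxE CE !mxE.
  have [->|/Elow le] := eqVneq (E i a) 0; first by rewrite !(mul0r, mulr0).
  by rewrite mulrCA -exprD subnKC.
rewrite eqmxMfull // row_full_unit unitmx_mul Bu /= unitmxE det_diag unitfE.
by apply/prodf_neq0 => i _; rewrite mxE expf_neq0 // gt_eqF.
Qed.

(** * Iterated derivatives of monomials *)

Section MonomialDerivatives.
Variables (R : realType) (d n : nat).

(** Coefficients are included so that the class is closed under [partial]; where an exponent
    truncates at 0, the coefficient is 0. *)
Definition monomial_map (c : 'I_n -> R) (a : 'I_n -> 'I_d -> nat)
    (t : 'rV[R]_d) : 'cV[R]_n :=
  \col_i (c i * \prod_j t 0 j ^+ a i j).

Lemma monomial_is_derive (c : R) (a : 'I_d -> nat) (j : 'I_d) (t : 'rV[R]_d) :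
  is_derive t (delta_mx 0 j : 'rV[R]_d) (fun u : 'rV[R]_d => c * \prod_i u 0 i ^+ a i)
    (c * (a j)%:R * \prod_i t 0 i ^+ (a i - (i == j))).
Proof.
(* Along direction [j] only one factor varies, so the difference quotient is that of the
   one-variable function [g]. *)
pose K := c * \prod_(i | i != j) t 0 i ^+ a i.
pose g (x : R) := K * x ^+ a j.
have e : (fun h : R => h^-1 *:
      (((fun u : 'rV[R]_d => c * \prod_i u 0 i ^+ a i) \o shift t)
         (h *: (delta_mx 0 j : 'rV[R]_d)) - c * \prod_i t 0 i ^+ a i)) =
    (fun h : R => h^-1 *: ((g \o shift (t 0 j)) (h *: (1 : R)) - g (t 0 j))).
  apply/funext => h; congr (_ *: (_ - _)) => /=.
    rewrite (bigD1 j) //= !mxE !eqxx [X in c * X]mulrC mulrA /g /K.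
    congr (_ * _ * _); apply: eq_bigr => i ij.
    by rewrite !mxE (negbTE ij) andbF mulr0 add0r.
  by rewrite (bigD1 j) //= /g /K mulrCA mulrC.
have [gd gE] : is_derive (t 0 j) (1 : R) g (K * ((a j)%:R * t 0 j ^+ (a j).-1)).
  have gE : g = K \*o (fun x : R => x ^+ a j) by [].
  split; first by rewrite gE; apply: derivableM; [exact: derivable_cst|exact: exprn_derivable].
  rewrite gE deriveMl; last exact: exprn_derivable.
  by rewrite exp_derive /GRing.scale /= mulr1.
split; first by rewrite /derivable e.
rewrite /derive e [LHS]gE /K [in RHS](bigD1 j) //= eqxx subn1.
have -> : \prod_(i | i != j) t 0 i ^+ (a i - (i == j)) =
    \prod_(i | i != j) t 0 i ^+ a i.
  by apply: eq_bigr => i /negbTE ->; rewrite subn0.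
by ring.
Qed.

Lemma partial_monomial_map c a j :
  partial j (monomial_map c a) =
  monomial_map (fun i => c i * (a i j)%:R) (fun i i' => a i i' - (i' == j))%N.
Proof.
apply/funext => t; rewrite /partial.
have e i (o : 'I_1) : (fun u => monomial_map c a u i o) =
    (fun u : 'rV[R]_d => c i * \prod_j u 0 j ^+ a i j).
  by apply/funext => u; rewrite mxE.
rewrite derive_mx; last first.
  apply/derivable_mxP => i o; rewrite e.
  by have [] := monomial_is_derive (c i) (a i) j t.
apply/colP => i; rewrite !mxE e.
by have [_ ->] := monomial_is_derive (c i) (a i) j t.
Qed.

Lemma iter_partial_monomial_map c a j b :
  iter b (partial j) (monomial_map c a) =
  monomial_map (fun i => c i * ((a i j) ^_ b)%:R)
    (fun i i' => a i i' - (i' == j) * b)%N.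
Proof.
elim: b => [|b IH].
  apply/funext => t; apply/colP => i; rewrite !mxE mulr1; congr (_ * _).
  by apply: eq_bigr => j' _; rewrite muln0 subn0.
rewrite iterS IH partial_monomial_map; apply/funext => t; apply/colP => i.
rewrite !mxE eqxx mul1n ffactnSr natrM mulrA; congr (_ * _).
by apply: eq_bigr => j' _; rewrite -subnDA mulnS addnC.
Qed.

Lemma foldr_partial_monomial_map c a (b : 'I_d -> nat) (s : seq 'I_d) : uniq s ->
  foldr (fun j g => iter (b j) (partial j) g) (monomial_map c a) s =
  monomial_map (fun i => c i * \prod_(j <- s) ((a i j) ^_ (b j))%:R)
    (fun i j => a i j - (j \in s) * b j)%N.
Proof.
elim: s => [_|j s IH /= /andP[js us]].
  apply/funext => t; apply/colP => i; rewrite !mxE big_nil mulr1; congr (_ * _).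
  by apply: eq_bigr => j' _; rewrite subn0.
rewrite IH // iter_partial_monomial_map; apply/funext => t; apply/colP => i.
rewrite !mxE big_cons (negbTE js) subn0; congr (_ * _); first by rewrite mulrCA mulrC.
apply: eq_bigr => j' _; rewrite inE; case: eqVneq => [->|_] /=.
  by rewrite (negbTE js) subn0.
by rewrite subn0.
Qed.

End MonomialDerivatives.

(** * Factorisation of the derivative matrix and conclusion *)

Lemma derivative_mxE (R : realType) d k l (t : 'rV[R]_d) :
    (forall j, t 0 j != 0) ->
  derivative_mx k l t =
    diag_mx (\row_a \prod_j t 0 j ^+ mexp a j) *m ffact_mx R d k l *m
    diag_mx (\row_b \prod_j t 0 j ^- mexp b j).
Proof.
move=> t0; apply/matrixP => a b; rewrite mul_diag_mx mul_mx_diag !mxE.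
have -> : @Phi R d k = monomial_map (fun=> 1) (@mexp d k).
  by apply/funext => u; apply/colP => i; rewrite !mxE mul1r.
rewrite /multi_partial (foldr_partial_monomial_map _ _ (mexp b)) ?enum_uniq //.
rewrite mxE mul1r big_enum /= -!big_split /=; apply: eq_bigr => j _.
rewrite mem_enum mul1n.
have [le|lt] := leqP (mexp b j) (mexp a j); last by rewrite ffact_small // !(mul0r, mulr0).
by rewrite expfB_cond ?(negbTE (t0 j)) // mulrC mulrAC.
Qed.

(** A spanning family with [\dim V] members is free. *)
Lemma columns_mx_free (R : realType) n (V : {vspace 'cV[R]_n})
    (v : (\dim V).-tuple 'cV[R]_n) :
  <<v>>%VS = V -> row_free (columns_mx v)^T.
Proof.
move=> hv; have /freeP fv : free v by rewrite /free hv size_tuple.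
apply: inj_row_free => u hu; apply/rowP => i; rewrite mxE.
apply: (fv (fun i => u 0 i)); apply/colP => a; rewrite summxE mxE.
have := congr1 (fun w : 'rV_ _ => w 0 a) hu; rewrite !mxE => hua.
rewrite -[RHS]hua.
by apply: eq_bigr => j _; rewrite !mxE (tnth_nth 0).
Qed.

Theorem theorem2p1 (R : realType) (d k l : nat)
    (V : {vspace 'cV[R]_(nd d k)})
    (v : (\dim V).-tuple 'cV[R]_(nd d k))
    (hd : (2 <= d)%N) (hk : (2 <= k)%N) (hl : (1 <= l <= k - 1)%N)
    (hV : (0 < \dim V < nd d k)%N)
    (hv : <<v>>%VS = V) :
  let r := ((\dim V * nd d l) %/ nd d k + 1)%N in
  exists (f : 'I_r -> 'I_(\dim V)) (g : 'I_r -> 'I_(nd d l)),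
    [/\ {homo f : i j / (i < j)%N},
        {homo g : i j / (i < j)%N} &
        ~ (forall t : 'rV[R]_d, unit_cube t ->
             \det (mxsub f g (derivative_mx_on l v t)) = 0)].
Proof.
move=> r.
have lk : (0 < l < k)%N by case/andP: hl => -> /=; rewrite subn1 -ltnS prednK // ltnW.
have nd_gt0 : (0 < nd d k)%N by case/andP: hV => _; exact: leq_ltn_trans.
have [p p_inj [s [s_gt0 s_le1 rk]]] :=
  ex_degeneration (ffact_mx R d k l) (@key_inj d k) (columns_mx_free hv).
(* At this point the monomial [a] takes the value [s ^+ key a], so the left diagonal factor is the
   scaling of [ex_degeneration]. *)
pose t : 'rV[R]_d := \row_j s ^+ weight k j.
have t_neq0 j : t 0 j != 0 by rewrite mxE expf_neq0 // gt_eqF.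
have cube_t : unit_cube t.
  by move=> j; rewrite mxE exprn_ge0 ?exprn_ile1 // ltW.
have r_le : (r <= \rank (derivative_mx_on l v t))%N.
  rewrite /derivative_mx_on derivative_mxE // !mulmxA mxrankMfree; last first.
    rewrite row_free_unit unitmxE det_diag unitfE; apply/prodf_neq0 => b _.
    by rewrite mxE; apply/prodf_neq0 => j _; rewrite invr_eq0 expf_neq0.
  have -> : (\row_(a < nd d k) \prod_j t 0 j ^+ mexp a j) = \row_a s ^+ key a.
    apply/rowP => a; rewrite !mxE /key expr_sum.
    by apply: eq_bigr => j _; rewrite mxE -exprM mulnC.
  (* The floor plus one is at most the rank exactly when the undivided inequality is strict. *)
  apply: leq_trans rk; rewrite /r addn1 ltn_divLR //.
  by apply: rank_ffact_rowsub_gt => //; exact: ltnW.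
have [f [g [f_homo g_homo fg]]] := rank_minor r_le.
by exists f, g; split => // /(_ t cube_t) /eqP; rewrite (negbTE fg).
Qed.
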